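(* Let $\mathbf{X}=\{X^n\}_{n=1}^\infty$ be a general source with finite alphabet $\mathcal{X}$, let $\hat{\mathcal{X}}$ be a finite output alphabet, let $\{c_n\}_{n=1}^\infty$, $c_n:\mathcal{X}^n\times\hat{\mathcal{X}}^n\to[0,\infty)$, be uniformly bounded cost functions, and let $\epsilon\ge0$. When $\mathbf{Y}=\mathbf{X}$ and $R\ge\log|\hat{\mathcal{X}}|$, the minimum worst-case cost under the weak independence criterion satisfies $$C_{\rm w}(\epsilon,R)=\inf_{\hat{\mathbf{X}}:\ I(\mathbf{X};\hat{\mathbf{X}})\le\epsilon}\overline{c}(\mathbf{X},\hat{\mathbf{X}}),$$ where the infimum is over all sequences $\hat{\mathbf{X}}=\{\hat X^n\}_{n=1}^\infty$ of random variables, $\hat X^n$ taking values in $\hat{\mathcal{X}}^n$ and jointly distributed with $X^n$, satisfying $I(\mathbf{X};\hat{\mathbf{X}})\le\epsilon$.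
   Context: $\mathcal{X},\hat{\mathcal{X}}$ are finite nonempty sets; $\log$ is the natural logarithm; $I(\cdot;\cdot)$ is mutual information. A general source $\mathbf{X}=\{X^n\}_{n=1}^\infty$ is an arbitrary sequence of random variables, $X^n$ taking values in $\mathcal{X}^n$ (no consistency between different $n$ is required). The condition $\mathbf{Y}=\mathbf{X}$ means $Y^n=X^n$ for all $n$. The cost functions $c_n:\mathcal{X}^n\times\hat{\mathcal{X}}^n\to[0,\infty)$ satisfy $\sup_{n\ge1}\sup_{(x^n,\hat x^n)}c_n(x^n,\hat x^n)<\infty$. For a positive integer $M_n$, $U_{M_n}$ is uniformly distributed on $\mathcal{U}_{M_n}=\{1,\dots,M_n\}$ and independent of $(X^n,Y^n)$. An encoder is a (deterministic) map $f_n:\mathcal{X}^n\times\mathcal{U}_{M_n}\to\hat{\mathcal{X}}^n$. For a sequence of real-valued random variables $Z_n$: $\mathrm{p}\text{-}\limsup_{n\to\infty}Z_n=\inf\{\alpha:\lim_{n\to\infty}\Pr\{Z_n>\alpha\}=0\}$. For $R,\Gamma,\epsilon\ge0$, $(R,\Gamma)$ is $\epsilon$-weakly achievable in the sense of the worst-case cost if there exist a sequence of positive integers $\{M_n\}$ and encoders $\{f_n\}$ such that $\limsup_{n\to\infty}\frac1n\log M_n\le R$, $\limsup_{n\to\infty}\frac1n I(Y^n;f_n(X^n,U_{M_n}))\le\epsilon$, and $\mathrm{p}\text{-}\limsup_{n\to\infty}c_n(X^n,f_n(X^n,U_{M_n}))\le\Gamma$. Define $C_{\rm w}(\epsilon,R)=\inf\{\Gamma\ge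 0:(R,\Gamma)\text{ is }\epsilon\text{-weakly achievable in the sense of the worst-case cost}\}$. Define $I(\mathbf{X};\hat{\mathbf{X}})=\limsup_{n\to\infty}\frac1nI(X^n;\hat X^n)$ and $\overline{c}(\mathbf{X},\hat{\mathbf{X}})=\mathrm{p}\text{-}\limsup_{n\to\infty}c_n(X^n,\hat X^n)$. *)

(* Defs.v *)
From HB Require Import structures.
From mathcomp Require Import all_boot all_order all_algebra.
From mathcomp Require Import all_classical all_reals all_analysis.

Set Implicit Arguments.
Unset Strict Implicit.
Unset Printing Implicit Defensive.

Import Order.TTheory GRing.Theory Num.Theory.
Import numFieldNormedType.Exports.

Local Open Scope classical_set_scope.
Local Open Scope ring_scope.

(* All random variables of interest are finite-valued, so they are given by
   their (joint) laws: a law on a finite type is a probability mass function,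
   and the random variables are functions on the type carrying the joint law.

   Sequences indexed by n >= 1 are indexed by all of nat; the term n = 0 is
   irrelevant, as only limits for n -> oo are taken. *)

Record fdist (R : realType) (W : finType) := FDist {
  pmf :> W -> R ;
  pmf_ge0 : forall w, 0 <= pmf w ;
  pmf_sum1 : \sum_w pmf w = 1 }.

Section FiniteProbability.
Context {R : realType}.

Definition Pr (W : finType) (P : fdist R W) (E : pred W) : R :=
  \sum_(w | E w) P w.

Section Law.
Variables (W A : finType) (P : fdist R W) (V : W -> A).

Let law_pmf (a : A) : R := Pr P [pred w | V w == a].

Lemma law_ge0 a : 0 <= law_pmf a.
Proof. by apply: sumr_ge0 => w _; exact: pmf_ge0. Qed.

Lemma law_sum1 : \sum_a law_pmf a = 1.
Proof. by rewrite -(pmf_sum1 P) (partition_big V xpredT). Qed.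

Definition law : fdist R A := FDist law_ge0 law_sum1.
End Law.

Section Uniform.
Variables (M : nat) (M_gt0 : (0 < M)%N).

Lemma uniform_ge0 (u : 'I_M) : 0 <= M%:R^-1 :> R.
Proof. by rewrite invr_ge0 ler0n. Qed.

Lemma uniform_sum1 : \sum_(u < M) M%:R^-1 = 1 :> R.
Proof.
by rewrite sumr_const card_ord -[LHS]mulr_natl divff // pnatr_eq0 -lt0n.
Qed.

Definition uniform : fdist R 'I_M := FDist uniform_ge0 uniform_sum1.
End Uniform.

Section Product.
Variables (A B : finType) (P : fdist R A) (Q : fdist R B).

Lemma prod_ge0 (w : A * B) : 0 <= P w.1 * Q w.2.
Proof. by rewrite mulr_ge0 ?pmf_ge0. Qed.

Lemma prod_sum1 : \sum_(w : A * B) P w.1 * Q w.2 = 1.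
Proof.
rewrite -(pair_big xpredT xpredT (fun a b => P a * Q b)) /=.
rewrite -(pmf_sum1 P); apply: eq_bigr => a _.
by rewrite -mulr_sumr (pmf_sum1 Q) mulr1.
Qed.

Definition indep_prod : fdist R (A * B)%type := FDist prod_ge0 prod_sum1.
End Product.

(* I(V; V'), in nats.  The convention 0 log 0 = 0 holds because of the leading
   factor; whenever that factor is nonzero, so is the denominator. *)
Definition mutual_info (W A B : finType) (P : fdist R W)
    (V : W -> A) (V' : W -> B) : R :=
  let J := law P (fun w => (V w, V' w)) in
  \sum_(a : A) \sum_(b : B)
    J (a, b) * ln (J (a, b) / (law P V a * law P V' b)).

Definition plimsup (W : nat -> finType) (P : forall n, fdist R (W n))
    (Z : forall n, W n -> R) : \bar R :=
  ereal_inf [set a%:E | a in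
    [set a : R | (fun n => Pr (P n) [pred w | a < Z n w]) @ \oo --> (0 : R)]].

End FiniteProbability.

Section WorstCaseCost.
Context {R : realType} (X Y Xh : finType).

(* PXY n is the joint law of (X^n, Y^n). *)
Variable PXY : forall n, fdist R (n.-tuple X * n.-tuple Y)%type.
Variable c : forall n, n.-tuple X -> n.-tuple Xh -> R.

Definition weakly_achievable (eps r Gam : R) : Prop :=
  exists (M : nat -> nat) (M_gt0 : forall n, (0 < M n)%N)
         (f : forall n, n.-tuple X -> 'I_(M n) -> n.-tuple Xh),
    (* the joint law of ((X^n, Y^n), U_{M_n}) *)
    let P n := indep_prod (PXY n) (uniform (M_gt0 n)) in
    [/\ (limn_esup (fun n => (n%:R^-1 * ln (M n)%:R)%:E) <= r%:E)%E,
        (limn_esup (fun n => (n%:R^-1 *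
           mutual_info (P n) (fun w => w.1.2) (fun w => f n w.1.1 w.2))%:E)
         <= eps%:E)%E
      & (plimsup P (fun n w => @c n w.1.1 (f n w.1.1 w.2)) <= Gam%:E)%E].

Definition min_worst_cost (eps r : R) : \bar R :=
  ereal_inf [set Gam%:E | Gam in
    [set Gam : R | 0 <= Gam /\ weakly_achievable eps r Gam]].

End WorstCaseCost.

Section JointlyDistributed.
Context {R : realType} (X Xh : finType).

(* Q n is the joint law of (X^n, Xh^n). *)
Variable Q : forall n, fdist R (n.-tuple X * n.-tuple Xh)%type.

Definition mutual_info_rate : \bar R :=
  limn_esup (fun n => (n%:R^-1 * mutual_info (Q n) fst snd)%:E).

Definition worst_cost (c : forall n, n.-tuple X -> n.-tuple Xh -> R) : \bar R :=
  plimsup Q (fun n w => c n w.1 w.2).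

Definition jointly_distributed_with
    (PX : forall n, fdist R (n.-tuple X)) : Prop :=
  forall n x, law (Q n) fst x = PX n x.

End JointlyDistributed.

(* Main.v *)
Require Import Defs.
From HB Require Import structures.
From mathcomp Require Import all_boot all_order all_algebra.
From mathcomp Require Import all_classical all_reals all_analysis.
From mathcomp Require Import ring lra.

Import Order.TTheory GRing.Theory Num.Theory.
Import numFieldNormedType.Exports.

Local Open Scope classical_set_scope.
Local Open Scope ring_scope.

(* Achievability: quantize each conditional law of Xh^n given X^n = x to
   multiples of 1/M_n, with M_n = (n+1) |Xh|^n, by rounding its cumulative sums.
   Each mass moves by at most 1/M_n, so the law of the cost moves by at most
   1/(n+1).  Writing I = sum_x p(x) sum_y h(k(y|x)) - sum_y h(r(y)) with
   h t = t ln t, and using |h s - h t| <= (1 + ln M)/M whenever |s - t| <= 1/M,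
   the mutual information moves by at most 2 (1 + ln M_n)/(n+1) = O(1).
   Conversely the joint law of the source and the encoder output is an
   admissible channel. *)

Set Implicit Arguments.
Unset Strict Implicit.

(** * Laws, marginals and expectations on finite types *)

Section Law.
Context {R : realType}.

Lemma PrE (W : finType) (P : fdist R W) (E : pred W) :
  Pr P E = \sum_w P w * (E w)%:R.
Proof.
rewrite /Pr big_mkcond; apply: eq_bigr => w _.
by case: (E w); rewrite ?mulr1 ?mulr0.
Qed.

(** Grouping the points [w] by the value [V w] gives this change of variables; with [PrE] it
    transports probabilities of events as well. *)
Lemma law_sum (W A : finType) (P : fdist R W) (V : W -> A) (g : A -> R) :
  \sum_a law P V a * g a = \sum_w P w * g (V w).
Proof.
rewrite [RHS](partition_big V xpredT) //=; apply: eq_bigr => a _.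
by rewrite mulr_suml; apply: eq_bigr => w /eqP ->.
Qed.

Lemma indep_prod_sum (A B : finType) (P : fdist R A) (Q : fdist R B)
    (g : A * B -> R) :
  \sum_w indep_prod P Q w * g w = \sum_a P a * \sum_b Q b * g (a, b).
Proof.
rewrite (eq_bigr (fun w => P w.1 * Q w.2 * g (w.1, w.2))); last by case.
rewrite -(pair_bigA _ (fun a b => P a * Q b * g (a, b))) /=.
by apply: eq_bigr => a _; rewrite mulr_sumr; apply: eq_bigr => b _; rewrite mulrA.
Qed.

Lemma Pr_law (W A : finType) (P : fdist R W) (V : W -> A) (E : pred A) :
  Pr (law P V) E = Pr P [pred w | E (V w)].
Proof. by rewrite !PrE (law_sum P V (fun a => (E a)%:R)). Qed.

Lemma law_marginl (W A B : finType) (P : fdist R W) (V : W -> A) (V' : W -> B) a :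
  law P V a = \sum_b law P (fun w => (V w, V' w)) (a, b).
Proof. by rewrite /= /Pr (partition_big V' xpredT). Qed.

Lemma law_marginr (W A B : finType) (P : fdist R W) (V : W -> A) (V' : W -> B) b :
  law P V' b = \sum_a law P (fun w => (V w, V' w)) (a, b).
Proof.
rewrite /= /Pr (partition_big V xpredT) //=.
by apply: eq_bigr => a _; apply: eq_bigl => w; rewrite /= xpair_eqE andbC.
Qed.

Lemma joint_law_lel (W A B : finType) (P : fdist R W) (V : W -> A) (V' : W -> B) a b :
  law P (fun w => (V w, V' w)) (a, b) <= law P V a.
Proof.
rewrite (law_marginl P V V') (bigD1 b)// lerDl sumr_ge0// => i _.
exact: Defs.pmf_ge0.
Qed.

Lemma joint_law_ler (W A B : finType) (P : fdist R W) (V : W -> A) (V' : W -> B) a b :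
  law P (fun w => (V w, V' w)) (a, b) <= law P V' b.
Proof.
rewrite (law_marginr P V V') (bigD1 a)// lerDl sumr_ge0// => i _.
exact: Defs.pmf_ge0.
Qed.

Lemma pmf_le1 (W : finType) (P : fdist R W) w : P w <= 1.
Proof.
by rewrite -(pmf_sum1 P) (bigD1 w) //= lerDl sumr_ge0 // => i _; exact: Defs.pmf_ge0.
Qed.

(** Both marginals are sums of the joint law, so the joint law alone fixes every summand. *)
Lemma eq_mutual_info (W1 W2 A B : finType) (P1 : fdist R W1) (P2 : fdist R W2)
    (V1 : W1 -> A) (V1' : W1 -> B) (V2 : W2 -> A) (V2' : W2 -> B) :
  (forall ab, law P1 (fun w => (V1 w, V1' w)) ab =
              law P2 (fun w => (V2 w, V2' w)) ab) ->
  mutual_info P1 V1 V1' = mutual_info P2 V2 V2'.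
Proof.
move=> J12; apply: eq_bigr => a _; apply: eq_bigr => b _.
rewrite J12 (law_marginl P1 V1 V1') (law_marginr P1 V1 V1').
rewrite (law_marginl P2 V2 V2') (law_marginr P2 V2 V2').
by congr (_ * ln (_ / (_ * _))); apply: eq_bigr.
Qed.

End Law.

(** * Continuity of mutual information in the joint law *)

Section MutualInformation.
Context {R : realType}.

(** For [b <= a], write the difference as [(a - b) ln a + b (ln a - ln b)]. It is at most [a - b],
    and at least [(a - b) ln a >= (a - b) ln (a - b)]. *)
Lemma xlnx_dist (a b m : R) : 0 <= a <= 1 -> 0 <= b <= 1 -> 1 <= m ->
  `|a - b| <= m^-1 -> `|a * ln a - b * ln b| <= (1 + ln m) / m.
Proof.
wlog ba : a b / b <= a => [wlg|].
  have [/wlg//|/ltW ab a01 b01 m1 abm] := leP b a.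
  by rewrite distrC wlg// distrC.
move=> /andP[a0 a1] /andP[b0 b1] m1; rewrite ger0_norm ?subr_ge0// => dm.
have m0 : 0 < m by exact: lt_le_trans m1.
have lnle (x : R) : 0 < x -> ln x <= x - 1.
  by move=> x0; rewrite -{1}(subrKC 1 x) le_ln1Dx// ltrBrDl subrr.
have lnm : 0 <= ln m by rewrite ln_ge0.
have rhs0 : m^-1 <= (1 + ln m) / m by rewrite ler_peMl ?invr_ge0 ?(ltW m0)// lerDl.
move: ba; rewrite le_eqVlt => /predU1P[->|ba].
  by rewrite subrr normr0 (le_trans _ rhs0)// invr_ge0 ltW.
have a_gt0 : 0 < a by exact: le_lt_trans ba.
have lna : ln a <= 0 by exact: ln_le0.
(* At [b = 0] the factor [b] cancels the default value of [ln 0]; for [b > 0] the second bound is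
   [ln t <= t - 1] at [t = a / b]. *)
have blnba : b * ln b <= b * ln a /\ b * (ln a - ln b) <= a - b.
  move: b0; rewrite le_eqVlt => /predU1P[<-|b0].
    by rewrite !mul0r subr0.
  split; first by rewrite ler_pM2l// ler_ln ?posrE// ltW.
  rewrite -ln_div ?posrE// (le_trans (ler_wpM2l (ltW b0) (lnle _ (divr_gt0 a_gt0 b0))))//.
  by rewrite mulrBr mulr1 mulrCA divff ?gt_eqF// mulr1.
have d0 : 0 < a - b by rewrite subr_gt0.
(* Taking [ln t <= t - 1] at [t = 1 / ((a - b) m)] and multiplying by [a - b] gives [-(a - b) ln (a
   - b) <= 1 / m + (a - b) ln m]. *)
have dlnd : - ((a - b) * ln (a - b)) <= (1 + ln m) / m.
  have := lnle (((a - b) * m)^-1); rewrite invr_gt0 mulr_gt0// => /(_ isT).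
  rewrite lnV ?posrE ?mulr_gt0// lnM ?posrE// -(ler_pM2l d0).
  rewrite invfM mulrBr mulrA divff ?gt_eqF// mul1r mulr1.
  have : (a - b) * ln m <= m^-1 * ln m by rewrite ler_wpM2r.
  rewrite [_ / m]mulrC; move: (m^-1) (ln m) (ln (a - b)) => ? ? ?; nra.
have dlna : (a - b) * ln (a - b) <= (a - b) * ln a.
  by rewrite ler_pM2l// ler_ln ?posrE// gerBl.
rewrite ler_norml; apply/andP; split; case: blnba; last by nra.
nra.
Qed.

(** The identity H(V') - H(V' | V): each logarithm is now paired with its own argument, a
    probability in [0,1], as [xlnx_dist] requires. *)
Lemma mutual_infoE (W A B : finType) (P : fdist R W) (V : W -> A) (V' : W -> B) :
  mutual_info P V V' =
  \sum_a law P V a * (\sum_b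
    law P (fun w => (V w, V' w)) (a, b) / law P V a *
    ln (law P (fun w => (V w, V' w)) (a, b) / law P V a)) -
  \sum_b law P V' b * ln (law P V' b).
Proof.
under [X in _ - X]eq_bigr => b _ do rewrite {1}(law_marginr P V V') mulr_suml.
rewrite [X in _ - X]exchange_big -sumrB; apply: eq_bigr => a _.
rewrite mulr_sumr -sumrB; apply: eq_bigr => b _.
have := joint_law_lel P V V' a b; have := joint_law_ler P V V' a b.
have := Defs.pmf_ge0 (law P (fun w => (V w, V' w))) (a, b).
move: (law P _ (a, b)) (law P V a) (law P V' b) => J p r.
(* A null joint mass kills both sides; a positive one forces both marginals to be positive, so the
   logarithms may be split. *)
rewrite le_eqVlt => /predU1P[<- _ _|J0 Jr Jp]; first by rewrite !mul0r mulr0 subrr.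
have p0 := lt_le_trans J0 Jp; have r0 := lt_le_trans J0 Jr.
rewrite !ln_div ?posrE ?mulr_gt0// lnM ?posrE//.
by field; rewrite gt_eqF.
Qed.

(** Two entropies are compared: that of the output, and the conditional one, row by row and averaged
    over [a]. Each comparison uses [xlnx_dist] once per element of [B]. *)
Lemma mutual_info_dist (W1 W2 A B : finType) (P1 : fdist R W1) (P2 : fdist R W2)
    (V1 : W1 -> A) (V1' : W1 -> B) (V2 : W2 -> A) (V2' : W2 -> B) (m : R) :
  1 <= m ->
  (forall a, law P1 V1 a = law P2 V2 a) ->
  (forall a b, `|law P1 (fun w => (V1 w, V1' w)) (a, b) -
                 law P2 (fun w => (V2 w, V2' w)) (a, b)| <= law P2 V2 a / m) ->
  `|mutual_info P1 V1 V1' - mutual_info P2 V2 V2'|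
    <= 2 * (#|B|%:R * ((1 + ln m) / m)).
Proof.
move=> m1 eqp J12; have m0 : 0 < m by exact: lt_le_trans m1.
have sumB (F G : B -> R) : (forall b, 0 <= F b <= 1) -> (forall b, 0 <= G b <= 1) ->
    (forall b, `|F b - G b| <= m^-1) ->
    `|\sum_b F b * ln (F b) - \sum_b G b * ln (G b)| <= #|B|%:R * ((1 + ln m) / m).
  move=> F01 G01 FG; rewrite -sumrB (le_trans (ler_norm_sum _ _ _))//.
  rewrite mulr_natl -sumr_const ler_sum// => b _; exact: xlnx_dist.
have law01 (W C : finType) (P : fdist R W) (V : W -> C) x : 0 <= law P V x <= 1.
  by rewrite Defs.pmf_ge0 pmf_le1.
have cond01 (W : finType) (P : fdist R W) (V : W -> A) (V' : W -> B) a b :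
    0 <= law P (fun w => (V w, V' w)) (a, b) / law P V a <= 1.
  have := joint_law_lel P V V' a b; have := Defs.pmf_ge0 (law P V) a.
  have := Defs.pmf_ge0 (law P (fun w => (V w, V' w))) (a, b).
  move: (law P _ (a, b)) (law P V a) => J p J0; rewrite le_eqVlt.
  case/predU1P => [<- _|p0 Jp]; first by rewrite invr0 mulr0 lexx ler01.
  by rewrite ler_pdivrMr// mul1r Jp divr_ge0// ltW.
rewrite !mutual_infoE opprD addrACA -opprD addrC (le_trans (ler_normD _ _))//.
rewrite mulr_natl mulr2n lerD//.
  (* Output entropy: the row errors [law P2 V2 a / m] add up to [1 / m]. *)
  rewrite normrN; apply: sumB => // b.
  rewrite (law_marginr P1 V1 V1') (law_marginr P2 V2 V2') -sumrB.
  rewrite (le_trans (ler_norm_sum _ _ _))// (le_trans (ler_sum _ (fun a _ => J12 a b)))//.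
  by rewrite -mulr_suml (pmf_sum1 (law P2 V2)) mul1r.
under eq_bigr do rewrite eqp.
rewrite -sumrB (le_trans (ler_norm_sum _ _ _))//.
rewrite -[leRHS]mul1r -[X in _ <= X * _](pmf_sum1 (law P2 V2)) mulr_suml ler_sum// => a _.
rewrite -mulrBr normrM ger0_norm ?Defs.pmf_ge0// ler_wpM2l ?Defs.pmf_ge0//.
apply: sumB => b; [by rewrite -eqp|by []|].
rewrite -mulrBl normrM normfV [X in _ / X]ger0_norm ?Defs.pmf_ge0//.
have := Defs.pmf_ge0 (law P2 V2) a.
(* On a null row the quotient is [0], since [0^-1 = 0]. *)
rewrite le_eqVlt => /predU1P[<-|p0]; first by rewrite invr0 mulr0 invr_ge0 ltW.
by rewrite ler_pdivrMr// mulrC J12.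
Qed.

End MutualInformation.

(** * Simulating a channel with a uniform seed *)

Section Quantization.
Context {R : realType}.

(** Differences of the integer parts of the cumulative sums telescope to the total, and each error
    is a difference of two fractional parts. Rounding the entries separately need not keep the
    sum. *)
Lemma exists_rounding (B : finType) (a : B -> R) (M : nat) :
  (forall b, 0 <= a b) -> \sum_b a b = M%:R ->
  exists2 g : B -> nat, (\sum_b g b)%N = M & forall b, `|(g b)%:R - a b| <= 1.
Proof.
move=> a0 aM.
have [b0 _|B0] := pickP (mem B); last first.
  have B00 : enum B = [::] by rewrite -[enum B]/(enum (mem B)) (eq_enum B0) enum0.
  exists (fun=> 0%N) => [|b]; last by have := B0 b.
  apply/eqP; rewrite -(eqr_nat R) -aM -!big_enum.
  by rewrite !(big_enum_cond, big_pred0).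
pose S k : R := \sum_(0 <= i < k) a (nth b0 (enum B) i).
have S0 k : 0 <= S k by apply: sumr_ge0.
have SS k : S k.+1 = S k + a (nth b0 (enum B) k) by rewrite /S big_nat_recr.
(* Monotonicity makes the truncated subtraction in [g] exact. *)
have leS k : (Num.truncn (S k) <= Num.truncn (S k.+1))%N.
  by rewrite le_truncn// SS lerDl.
pose g b := (Num.truncn (S (index b (enum B)).+1) - Num.truncn (S (index b (enum B))))%N.
exists g => [|b].
  rewrite -big_enum (big_nth b0) big_nat.
  under eq_bigr => i /andP[_ iN] do rewrite /g index_uniq ?enum_uniq//.
  rewrite -big_nat telescope_sumn//.
    rewrite /S (big_geq (leqnn 0)) truncn0 subn0 -(big_nth b0 xpredT a) big_enum aM.
    exact: natrK.
  by apply: homo_leq => //; exact: leq_trans.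
rewrite /g; set k := index _ _.
have -> : a b = S k.+1 - S k by rewrite SS addrAC subrr add0r nth_index ?mem_enum.
rewrite natrB//; have /andP[] := truncn_itv (S0 k); have /andP[] := truncn_itv (S0 k.+1).
rewrite ler_norml -!natr1; move: (S k) (S k.+1) => s t; lra.
Qed.

(** Round the masses [M q(b)] to integers [g b] and send [g b] of the [M] equally likely seeds to
    [b]. *)
Lemma exists_quantizer (B : finType) (q : fdist R B) (M : nat) (M_gt0 : (0 < M)%N) :
  exists f : 'I_M -> B, forall b, `|law (uniform M_gt0) f b - q b| <= M%:R^-1.
Proof.
have M0 : (0 : R) < M%:R by rewrite ltr0n.
have [b||g gM gq] := @exists_rounding B (fun b => M%:R * q b) M.
  by rewrite mulr_ge0 ?Defs.pmf_ge0.
  by rewrite -mulr_sumr (pmf_sum1 q) mulr1.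
(* The seeds are identified with the pairs of a symbol [b] and an index below [g b]; the map is the
   first projection. *)
have cT : M = #|{: {b : B & 'I_(g b)}}|.
  rewrite card_tagged -gM sumnE big_map big_enum.
  by apply: eq_bigr => b _; rewrite card_ord.
exists (fun u => tag (enum_val (cast_ord cT u))) => b.
have -> : law (uniform M_gt0) (fun u => tag (enum_val (cast_ord cT u))) b
    = M%:R^-1 * (g b)%:R :> R.
  rewrite /= /Pr /=.
  rewrite (reindex (fun t => cast_ord (esym cT) (enum_rank t))) /=; last first.
    apply: onW_bij; exists (fun u => enum_val (cast_ord cT u)) => [t|u].
      by rewrite cast_ordKV enum_rankK.
    by rewrite enum_valK cast_ordK.
  under eq_bigl => t do rewrite cast_ordKV enum_rankK -[_ == b]andbT.
  rewrite -(sig_big_dep (pred1 b) (fun=> xpredT) (fun _ _ => M%:R^-1 : R)).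
  by rewrite big_pred1_eq sumr_const card_ord mulr_natr.
have -> : M%:R^-1 * (g b)%:R - q b = M%:R^-1 * ((g b)%:R - M%:R * q b).
  by rewrite mulrBr mulKf// gt_eqF.
by rewrite normrM ger0_norm ?invr_ge0 ?ler0n// ler_piMr ?invr_ge0 ?ler0n.
Qed.

(** Each row is quantized through its conditional law. Multiplying by [law J fst a] keeps the bound
    meaningful on null rows. *)
Lemma exists_channel_quantizer (A B : finType) (J : fdist R (A * B)%type) (M : nat)
    (M_gt0 : (0 < M)%N) :
  exists f : A -> 'I_M -> B, forall a b,
    `|law J fst a * law (uniform M_gt0) (f a) b - J (a, b)| <= law J fst a / M%:R.
Proof.
have /boolp.choice[f fP] : forall a, exists f : 'I_M -> B, forall b,
    `|law J fst a * law (uniform M_gt0) f b - J (a, b)| <= law J fst a / M%:R;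
  last by exists f.
move=> a.
have pE : law J fst a = \sum_b J (a, b).
  rewrite (law_marginl J fst snd); apply: eq_bigr => b _ /=.
  by rewrite /Pr (big_pred1 (a, b))// => -[].
have [p0|p0] := eqVneq (law J fst a) 0.
  (* On a null row any symbol will do; one exists because [J] has total mass 1. *)
  have [b _] : exists b : B, True.
    have [b _|B0] := pickP (mem B); first by exists b.
    have := pmf_sum1 J; rewrite big_pred0 => [/esym/eqP|[x y]]; first by rewrite oner_eq0.
    by have := B0 y.
  exists (fun=> b) => b'; rewrite p0 !mul0r sub0r normrN.
  have /psumr_eq0P : \sum_b J (a, b) = 0 by rewrite -pE.
  by move=> ->//; [rewrite normr0|move=> *; exact: Defs.pmf_ge0].
have q0 b : 0 <= J (a, b) / law J fst a by rewrite divr_ge0 ?Defs.pmf_ge0.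
have q1 : \sum_b J (a, b) / law J fst a = 1 by rewrite -mulr_suml -pE divff.
have [f fq] := exists_quantizer (FDist q0 q1) M_gt0.
exists f => b; rewrite -[X in _ - X](mulKf p0) mulrCA -mulrBr normrM.
by rewrite ger0_norm ?Defs.pmf_ge0// ler_wpM2l ?Defs.pmf_ge0// mulrC.
Qed.

End Quantization.

(** * Limits superior and elementary convergence rates *)

Section Limits.
Context {R : realType}.

(** For any [d > 0], eventually [u n < l + d / 2] and [e n < d / 2], hence [v n < l + d]. *)
Lemma limn_esup_le_vanishing (u v e : R^nat) (l : R) :
  (forall n, v n <= u n + e n) -> e @ \oo --> (0 : R) ->
  (limn_esup (fun n => (u n)%:E) <= l%:E)%E ->
  (limn_esup (fun n => (v n)%:E) <= l%:E)%E.
Proof.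
move=> vue e0 ul; apply/lee_addgt0Pr => d d0.
have d20 : 0 < d / 2 by rewrite divr_gt0.
have : (limn_esup (fun n => (u n)%:E) < (l + d / 2)%:E)%E.
  by rewrite (le_lt_trans ul)// lte_fin ltrDl.
rewrite /limn_esup limf_esupE => /ereal_inf_lt[_ [V Voo <-]] supV.
rewrite limf_esupE.
pose V' := V `&` [set n | e n < d / 2].
apply: (@le_trans _ _ (ereal_sup [set (v n)%:E | n in V'])).
  apply: ereal_inf_lbound; exists V' => //; apply: filterI => //.
  exact: cvgr_lt e0 _ d20.
apply: ge_ereal_sup => _ [n [Vn /= en] <-].
have : ((u n)%:E < (l + d / 2)%:E)%E.
  by apply: le_lt_trans supV; apply: ereal_sup_ubound; exists n.
by rewrite -EFinD lte_fin lee_fin => un; have := vue n; lra.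
Qed.

Lemma ln_natS_le n : ln n.+1%:R <= n%:R :> R.
Proof. by rewrite -natr1 addrC le_ln1Dx// (lt_le_trans (ltrN10 _)). Qed.

(** The factor 2 absorbs the off-by-one; at [n = 0] the left side is [0^-1 = 0]. *)
Lemma invn_le_harmonic n : n%:R^-1 <= 2 * harmonic n :> R.
Proof.
rewrite /harmonic /=; case: n => [|n]; first by rewrite invr0 mulr_ge0 ?invr_ge0.
rewrite ler_pdivlMr ?ltr0n// mulrC ler_pdivrMr ?ltr0n//.
by rewrite -natrM ler_nat mul2n -addnn addSn addnS !ltnS leq_addr.
Qed.

Lemma cvg_invn : (fun n => n%:R^-1 : R) @ \oo --> (0 : R).
Proof.
apply: (@squeeze_cvgr _ _ _ _ (fun=> 0) (fun n => 2 * harmonic n) _).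
- by near=> n; rewrite invr_ge0 ler0n invn_le_harmonic.
- exact: cvg_cst.
- rewrite -[X in _ --> X](mulr0 2); apply: cvgM; [exact: cvg_cst|exact: cvg_harmonic].
Unshelve. all: by end_near. Qed.

(** With [s = sqrt (n + 1)], the bounds [ln (n + 1) = 2 ln s <= 2 s] and [1 / n <= 2 / s^2] give at
    most [4 / s]. *)
Lemma cvg_ln_natS_div : (fun n => n%:R^-1 * ln n.+1%:R : R) @ \oo --> (0 : R).
Proof.
apply: (@squeeze_cvgr _ _ _ _ (fun=> 0) (fun n => 4 * Num.sqrt (harmonic n)) _).
- near=> n; rewrite mulr_ge0 ?invr_ge0 ?ler0n ?ln_ge0 ?ler1n//=.
  set s : R := Num.sqrt n.+1%:R.
  have s0 : 0 < s by rewrite sqrtr_gt0 ltr0n.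
  have sE : n.+1%:R = s ^+ 2 by rewrite sqr_sqrtr ?ler0n.
  have -> : Num.sqrt (harmonic n) = s^-1.
    by rewrite /harmonic /= sE -exprVn sqrtr_sqr ger0_norm// invr_ge0 ltW.
  have lns : ln n.+1%:R <= 2 * s.
    by rewrite sE lnXn// mulr_natl ler_wMn2r// ltW// ln_sublinear.
  rewrite (le_trans (ler_pM _ _ (invn_le_harmonic n) lns))//.
    by rewrite ln_ge0// ler1n.
  rewrite /harmonic /= sE (_ : 2 * _ * _ = 4 * s^-1)//.
  by field; exact: lt0r_neq0.
- exact: cvg_cst.
- rewrite -[X in _ --> X](mulr0 4); apply: cvgM; first exact: cvg_cst.
  rewrite -[X in _ --> X]sqrtr0.
  exact: (cvg_comp _ _ cvg_harmonic (@sqrt_continuous R 0)).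
Unshelve. all: by end_near. Qed.

End Limits.

(** * Laws induced by an encoder when the source equals its copy *)

Section Encoder.
Context {R : realType}.
Variables (X B : finType) (PX : fdist R X) (M : nat) (M_gt0 : (0 < M)%N).
Variable f : X -> 'I_M -> B.

Let P := indep_prod (law PX (fun x => (x, x))) (uniform M_gt0).

(** The event may depend on the source, its copy and the output; the diagonal law makes the first
    two arguments equal. *)
Lemma encoder_Pr (E : X -> X -> B -> bool) :
  Pr P [pred w | E w.1.1 w.1.2 (f w.1.1 w.2)] =
  \sum_x PX x * \sum_y law (uniform M_gt0) (f x) y * (E x x y)%:R.
Proof.
rewrite PrE indep_prod_sum.
rewrite (law_sum PX (fun x => (x, x)) (fun w => \sum_u uniform M_gt0 u *
  (E w.1 w.2 (f w.1 u))%:R)).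
apply: eq_bigr => x _; congr (_ * _).
by rewrite (law_sum (uniform M_gt0) (f x) (fun y => (E x x y)%:R)).
Qed.

Lemma encoder_law_source x : law P (fun w => w.1.2) x = PX x.
Proof.
rewrite -[LHS]/(Pr P _) (encoder_Pr (fun _ x' _ => x' == x)).
rewrite (bigD1 x)//= [X in _ + X]big1 => [|x' /negbTE x'x]; last first.
  by rewrite big1 ?mulr0// => y _; rewrite x'x mulr0.
by rewrite eqxx -mulr_suml (pmf_sum1 (law _ (f x))) !mulr1 addr0.
Qed.

Lemma encoder_law_joint x y :
  law P (fun w => (w.1.2, f w.1.1 w.2)) (x, y) =
  PX x * law (uniform M_gt0) (f x) y.
Proof.
rewrite -[LHS]/(Pr P _) (encoder_Pr (fun _ x' y' => (x', y') == (x, y))).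
rewrite (bigD1 x)//= [X in _ + X]big1 => [|x' /negbTE x'x]; last first.
  by rewrite big1 ?mulr0// => y' _; rewrite xpair_eqE x'x mulr0.
rewrite addr0 (bigD1 y)//= [X in _ + X]big1 => [|y' /negbTE y'y].
  by rewrite addr0 eqxx mulr1.
by rewrite xpair_eqE y'y andbF mulr0.
Qed.

End Encoder.

(** * Passing between encoders and channels *)

Section WorstCost.
Context {R : realType} (X Xh : finType).
Variables (PX : forall n, fdist R (n.-tuple X)).
Variable c : forall n, n.-tuple X -> n.-tuple Xh -> R.
Arguments c : clear implicits.

(** The information criterion involves the copy [w.1.2], while the channel starts from [w.1.1]; by
    [encoder_Pr] both have the same joint law with the output. *)
Lemma achievable_channel (eps r Gam : R) :
  weakly_achievable (fun n => law (PX n) (fun x => (x, x))) c eps r Gam ->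
  exists Q : forall n, fdist R (n.-tuple X * n.-tuple Xh)%type,
    [/\ jointly_distributed_with Q PX, (mutual_info_rate Q <= eps%:E)%E &
        (worst_cost Q c <= Gam%:E)%E].
Proof.
move=> [M [M_gt0 [f [_ I_le c_le]]]].
exists (fun n => law (indep_prod (law (PX n) (fun x => (x, x))) (uniform (M_gt0 n)))
                     (fun w => (w.1.1, f n w.1.1 w.2))); split.
- move=> n x; rewrite -[LHS]/(Pr _ _) Pr_law.
  rewrite (encoder_Pr (PX n) (M_gt0 n) (f n) (fun x' _ _ => x' == x)).
  rewrite -(encoder_law_source (PX n) (M_gt0 n) (f n) x) -[RHS]/(Pr _ _).
  by rewrite (encoder_Pr (PX n) (M_gt0 n) (f n) (fun _ x' _ => x' == x)).
- move: I_le; congr (limn_esup _ <= _)%E; apply/funext => n; congr (_ * _)%:E.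
  apply: eq_mutual_info => -[x y].
  rewrite -[RHS]/(Pr _ _) Pr_law.
  rewrite (encoder_Pr (PX n) (M_gt0 n) (f n) (fun x' _ y' => (x', y') == (x, y))).
  rewrite -[LHS]/(Pr _ _).
  by rewrite (encoder_Pr (PX n) (M_gt0 n) (f n) (fun _ x' y' => (x', y') == (x, y))).
- move: c_le; congr (ereal_inf (image _ _) <= _)%E.
  apply/funext => a /=.
  by under [in RHS]eq_fun do rewrite Pr_law.
Qed.

(** The cost enters through one level [a] of vanishing exceedance probability, which passes to the
    encoder unchanged; the infimum over levels is taken afterwards. *)
Lemma channel_achievable (eps r a : R)
    (Q : forall n, fdist R (n.-tuple X * n.-tuple Xh)%type) :
  (0 < #|Xh|)%N -> ln (#|Xh|%:R : R) <= r ->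
  jointly_distributed_with Q PX -> (mutual_info_rate Q <= eps%:E)%E ->
  (fun n => Pr (Q n) [pred w | a < c n w.1 w.2]) @ \oo --> (0 : R) ->
  weakly_achievable (fun n => law (PX n) (fun x => (x, x))) c eps r a.
Proof.
move=> Xh_gt0 hr QPX I_le c_to0.
pose N n := #|{: n.-tuple Xh}|.
have NE n : N n = (#|Xh| ^ n)%N by exact: card_tuple.
have N_gt0 n : (0 < N n)%N by rewrite NE expn_gt0 Xh_gt0.
(* The factor [N n] offsets summing the [1 / M n] errors over all outputs, and [n + 1] makes the
   total vanish, at a rate cost of only [ln (n + 1) / n]. *)
pose M n := (n.+1 * N n)%N.
have M_gt0 n : (0 < M n)%N by rewrite muln_gt0 N_gt0.
have lnK0 : 0 <= ln #|Xh|%:R :> R by rewrite ln_ge0// ler1n.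
have lnM n : ln (M n)%:R = ln n.+1%:R + n%:R * ln #|Xh|%:R :> R.
  rewrite natrM exp.lnM ?posrE ?ltr0n ?N_gt0//.
  by rewrite NE natrX lnXn ?ltr0n// mulr_natl.
have NM n : (N n)%:R * (M n)%:R^-1 = n.+1%:R^-1 :> R.
  by rewrite natrM invfM mulrCA divff ?mulr1// pnatr_eq0 -lt0n.
pose f n := sval (cid (exists_channel_quantizer (Q n) (M_gt0 n))).
have fQ n x y : `|PX n x * law (uniform (M_gt0 n)) (f n x) y - Q n (x, y)|
    <= PX n x / (M n)%:R.
  by have := svalP (cid (exists_channel_quantizer (Q n) (M_gt0 n))) x y; rewrite QPX.
exists M, M_gt0, f => P; split.
- apply: (limn_esup_le_vanishing (u := fun=> r) _ cvg_ln_natS_div) => [n|].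
    (* At [n = 0] the inverse is [0], and [0 <= ln #|Xh| <= r] closes the case. *)
    rewrite lnM mulrDr addrC lerD2r; case: n => [|n].
      by rewrite invr0 mul0r (le_trans lnK0).
    by rewrite mulKf// pnatr_eq0.
  by rewrite (cvg_limn_einf_sup (cvg_cst r%:E)).2.
(* Since [ln (n + 1) <= n], the shift [2 (1 + ln M_n) / (n + 1)] is at most [2 (1 + ln #|Xh|)];
   dividing by [n] makes it vanish. *)
- apply: (limn_esup_le_vanishing
    (e := fun n => 2 * (1 + ln #|Xh|%:R) * n%:R^-1) _ _ I_le) => [n|]; last first.
    rewrite -[X in _ --> X](mulr0 (2 * (1 + ln #|Xh|%:R))).
    by apply: cvgM; [exact: cvg_cst|exact: cvg_invn].
  rewrite -lerBlDl -mulrBr mulrC ler_wpM2r ?invr_ge0//.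
  apply: (le_trans (ler_norm _)).
  apply: (le_trans (mutual_info_dist (m := (M n)%:R) _ _ _)).
  + by rewrite ler1n.
  + by move=> x; rewrite (encoder_law_source _ _ (f n)) QPX.
  + move=> x y; rewrite encoder_law_joint QPX.
    have -> : law (Q n) (fun w => (w.1, w.2)) (x, y) = Q n (x, y).
      by rewrite /= /Pr (big_pred1 (x, y))// => -[].
    exact: fQ.
  + rewrite -/(N n) ler_pM2l// [_ / _]mulrC mulrA NM.
    rewrite mulrC ler_pdivrMr ?ltr0n// lnM.
    have := ln_natS_le (R := R) n; have : 0 <= n%:R :> R by [].
    rewrite -natr1; move: lnK0; move: n%:R (ln #|Xh|%:R) (ln (_ + 1)) => x K L; nra.
- apply: ereal_inf_lbound; exists a => //=.
  (* The errors [PX n x / M n], summed over [x] and [y], give [N n / M n = 1 / (n + 1)]. *)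
  apply: (@squeeze_cvgr _ _ _ _ (fun=> 0)
    (fun n => Pr (Q n) [pred w | a < c n w.1 w.2] + harmonic n) _).
  + near=> n; rewrite sumr_ge0 => [|w _]; last exact: Defs.pmf_ge0.
    rewrite (encoder_Pr (PX n) (M_gt0 n) (f n) (fun x _ y => a < c n x y)) PrE.
    rewrite (eq_bigr (fun w => Q n (w.1, w.2) * (a < c n w.1 w.2)%R%:R)); last by case.
    rewrite -(pair_bigA _ (fun x y => Q n (x, y) * (a < c n x y)%R%:R)) /=.
    rewrite -[X in _ <= _ + X]mul1r -[X in _ <= _ + X * _](pmf_sum1 (PX n)).
    rewrite mulr_suml -big_split ler_sum// => x _.
    rewrite mulr_sumr -NM mulrCA.
    rewrite mulr_natl -sumr_const -big_split ler_sum// => y _.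
    rewrite mulrA -lerBlDl -mulrBl.
    case: (a < _); rewrite ?mulr1 ?mulr0 ?divr_ge0 ?Defs.pmf_ge0//.
    exact: le_trans (ler_norm _) (fQ n x y).
  + exact: cvg_cst.
  + by rewrite -[X in _ --> X](addr0 0); apply: cvgD => //; exact: cvg_harmonic.
Unshelve. all: by end_near. Qed.

End WorstCost.

(** A negative level is exceeded with probability 1 for every [n >= 1]. This supplies the constraint
    [0 <= Gam] in [min_worst_cost]. *)
Lemma cost_level_ge0 {R : realType} (W : nat -> finType) (P : forall n, fdist R (W n))
    (Z : forall n, W n -> R) (a : R) :
  (forall n w, (0 < n)%N -> 0 <= Z n w) ->
  (fun n => Pr (P n) [pred w | a < Z n w]) @ \oo --> (0 : R) -> 0 <= a.
Proof.
move=> Z0 PZ; rewrite leNgt; apply/negP => a0.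
have Pr_lt1 : \forall n \near \oo, Pr (P n) [pred w | a < Z n w] < 1.
  exact: cvgr_lt PZ _ ltr01.
have [n [/= Pr1 n0]] := filter_ex (filterI Pr_lt1 (nbhs_infty_gt 0)).
suff Pr_eq1 : Pr (P n) [pred w | a < Z n w] = 1 by rewrite Pr_eq1 ltxx in Pr1.
rewrite -(pmf_sum1 (P n)); apply: eq_bigl => w /=.
exact: lt_le_trans a0 (Z0 n w n0).
Qed.

Unset Implicit Arguments.
Set Strict Implicit.

Theorem corollary2 (R : realType) (X Xh : finType)
  (X_gt0 : (0 < #|X|)%N) (Xh_gt0 : (0 < #|Xh|)%N)
  (PX : forall n : nat, fdist R (n.-tuple X))
  (c : forall n : nat, n.-tuple X -> n.-tuple Xh -> R)
  (c_ge0 : forall (n : nat) (x : n.-tuple X) (y : n.-tuple Xh),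
    (0 < n)%N -> 0 <= c n x y)
  (c_bounded : exists B : R,
    forall (n : nat) (x : n.-tuple X) (y : n.-tuple Xh),
      (0 < n)%N -> c n x y <= B)
  (eps r : R) (eps_ge0 : 0 <= eps) (hr : ln (#|Xh|%:R : R) <= r) :
  min_worst_cost (fun n => law (PX n) (fun x => (x, x))) c eps r =
  ereal_inf [set worst_cost Q c | Q in
    [set Q : forall n : nat, fdist R (n.-tuple X * n.-tuple Xh)%type |
      jointly_distributed_with Q PX /\ (mutual_info_rate Q <= eps%:E)%E]].
Proof.
apply/eqP; rewrite eq_le; apply/andP; split.
(* Both infima on the right are opened: a channel, then a level [a] from its p-limsup, which itself
   serves as an achievable [Gam]. *)
- apply: le_ereal_inf_tmp => _ [Q [QPX I_le] <-].
  apply: le_ereal_inf_tmp => _ [a /= c_to0 <-].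
  apply: ereal_inf_lbound; exists a => //; split.
    by apply: (cost_level_ge0 _ c_to0) => n w; exact: c_ge0.
  exact: (channel_achievable Xh_gt0 hr QPX I_le c_to0).
- apply: le_ereal_inf_tmp => _ [Gam [_ /achievable_channel[Q [QPX I_le c_le]]] <-].
  by apply: le_trans c_le; apply: ereal_inf_lbound; exists Q.
Qed.
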